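(* There exist arbitrarily large maximal planar graphs $G$ with $\chi(G) = mp(G) = 4$; that is, for every $N$ there is a maximal planar graph $G$ with at least $N$ vertices whose chromatic number $\chi(G)$ equals $4$ and which satisfies $mp(G) = 4$.
   Context: Graphs are finite and simple. A path $P = v_1 v_2 \ldots v_k$ (distinct vertices, consecutive ones adjacent) in a graph $G$ is a degree monotone path of length $k$ if $\deg(v_1) \leq \deg(v_2) \leq \ldots \leq \deg(v_k)$ or $\deg(v_1) \geq \deg(v_2) \geq \ldots \geq \deg(v_k)$, where degrees are taken in $G$; thus the length of a path is its number of vertices. $mp(G)$ denotes the maximum length of a degree monotone path in $G$. A maximal planar graph is a planar graph such that adding any edge between two nonadjacent vertices yields a nonplanar graph. *)

(* Defs.v *)
(* Libraries: MathComp and MathComp-Analysis *)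
From HB Require Import structures.
From mathcomp Require Import all_boot all_order all_algebra.
From mathcomp Require Import all_classical all_reals all_analysis.
Import Order.TTheory GRing.Theory Num.Theory.
Import numFieldNormedType.Exports.

Set Implicit Arguments.
Unset Strict Implicit.
Unset Printing Implicit Defensive.

Record sgraph := SGraph {
  vertex :> finType;
  adj : rel vertex;
  adj_sym : symmetric adj;
  adj_irr : irreflexive adj }.

Definition add_edge_rel (G : sgraph) (x y : G) : rel G :=
  fun u v => adj u v || ((u != v) && ([set u; v]%SET == [set x; y]%SET)).

Lemma add_edge_sym (G : sgraph) (x y : G) : symmetric (add_edge_rel x y).
Proof.
by move=> u v; rewrite /add_edge_rel adj_sym eq_sym [[set u; v]%SET]finset.setUC.
Qed.

Lemma add_edge_irr (G : sgraph) (x y : G) : irreflexive (add_edge_rel x y).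
Proof. by move=> u; rewrite /add_edge_rel adj_irr eqxx. Qed.

(* G + xy; it is G itself when x = y. *)
Definition add_edge (G : sgraph) (x y : G) : sgraph :=
  SGraph (add_edge_sym x y) (add_edge_irr x y).

Section Planarity.
Local Open Scope classical_set_scope.
Local Open Scope ring_scope.
Variable R : realType.

Definition plane_arc (p q : R * R) (A : set (R * R)) : Prop :=
  exists f : R -> R * R,
    [/\ {within `[0, 1], continuous f},
        {in `[0, 1] &, injective f},
        f 0 = p, f 1 = q & f @` `[0, 1] = A].

(* [pt] places the vertices and [A x y] is the (closed) arc drawn for the edge
   xy. The last two conditions say that the arc of an edge, deprived of its
   two endpoints, contains no vertex and no point of another edge. *)
Definition plane_drawing (G : sgraph) (pt : G -> R * R)
    (A : G -> G -> set (R * R)) : Prop :=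
  [/\ injective pt,
      forall x y : G, adj x y -> A x y = A y x,
      forall x y : G, adj x y -> plane_arc (pt x) (pt y) (A x y),
      forall x y z : G, adj x y -> A x y (pt z) -> z = x \/ z = y
    & forall x y u v : G, adj x y -> adj u v ->
        [set x; y]%SET != [set u; v]%SET ->
        A x y `&` A u v `<=` [set pt x; pt y] ].

Definition planar (G : sgraph) : Prop :=
  exists (pt : G -> R * R) (A : G -> G -> set (R * R)), plane_drawing pt A.

Definition maximal_planar (G : sgraph) : Prop :=
  planar G /\
  forall x y : G, x != y -> ~~ adj x y -> ~ planar (add_edge x y).

End Planarity.

Definition colorable (G : sgraph) (k : nat) : bool :=
  [exists c : {ffun G -> 'I_k}, forall x, forall y, adj x y ==> (c x != c y)].

Lemma colorable_card (G : sgraph) : exists k, colorable G k.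
Proof.
exists #|G|; apply/existsP; exists [ffun x => enum_rank x].
apply/forallP => x; apply/forallP => y; apply/implyP => xy.
rewrite !ffunE (inj_eq enum_rank_inj); apply: contraTneq xy => ->.
by rewrite adj_irr.
Qed.

Definition chromatic_number (G : sgraph) : nat := ex_minn (colorable_card G).

Definition deg (G : sgraph) (x : G) : nat := #|[set y | adj x y]%SET|.

Definition degree_monotone_path (G : sgraph) (p : seq G) : bool :=
  [&& uniq p, sorted (@adj G) p
    & sorted leq (map (@deg G) p) || sorted geq (map (@deg G) p)].

(* The length of a path is its number of vertices, hence at most #|G|. *)
Definition mp (G : sgraph) : nat :=
  \max_(k < #|G|.+1 | [exists p : k.-tuple G, degree_monotone_path p]) k.

(* Main.v *)
Require Import Defs.
From mathcomp Require Import all_boot all_order all_algebra.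
From mathcomp Require Import all_classical all_reals all_analysis.
From mathcomp Require Import ring lra zify.
Import Order.TTheory GRing.Theory Num.Theory.
Import numFieldNormedType.Exports.

Set Implicit Arguments.
Unset Strict Implicit.
Unset Printing Implicit Defensive.

(** The graphs are capped bipyramids.  Take a bipyramid over a cycle
    c_0 ... c_(3m-1), m >= 2, with two nonadjacent poles, and inside every third
    upper triangle, the one on c_(3j+1) and c_(3j+2), put a vertex of degree 3,
    a cap, joined to the three corners.  Caps have degree 3, the c_(3j) degree
    4, the other rim vertices degree 5, and the poles degree at least 6.

    [mp = 4]: along a nondecreasing path nothing comes before a cap or a c_(3j),
    since these vertices have the least degrees and form an independent set, and
    nothing comes after a pole, since the poles have the greatest degrees.  So the
    inner vertices of a path with five vertices would be three distinct rim
    vertices of degree 5 in a row, whereas these come in separate adjacent pairs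
    ([climb_size]).  A cap together with its triangle is a K4, whose vertices
    sorted by degree give a path of length 4.

    [chi = 4]: colour c_i by i mod 3, the poles by a fourth colour, and each cap
    by the colour of c_0; the K4 excludes three colours.

    Planarity: draw the rim on a horizontal axis, the poles above and below it,
    all edges straight except the one closing the rim, which is a parabola
    passing over the upper pole ([capped_bipyramid_planar]).

    Maximality: for two nonadjacent vertices x and y, the graph with xy added
    contains a subdivision of K5 having x and y among its branch vertices
    ([new_edge_nonplanar]).  It remains to see that a subdivided K5 has no
    drawing by continuous arcs ([K5_subdivision_nonplanar]).  Paths
    subdividing independent edges are disjoint compact sets, hence a positive
    distance apart, so that they may be replaced by finite chains of points with
    tiny steps.  For two such chains a and b, the differences a_s - b_t stay far
    from 0, so the winding number of the boundary of the grid (s, t) about 0 is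
    zero ([wind_disjoint]).  This gives one integer equation for each of the 15
    pairs of independent edges of K5, and the sum of these equations equates an
    even number with an odd one ([no_K5_chains]); this is van Kampen's
    obstruction modulo 2. *)

(** * The five-point obstruction for discrete chains *)

Lemma mem_tail (T : eqType) (x y : T) s : y \in s -> y \in x :: s.
Proof. by rewrite in_cons orbC => ->. Qed.

Section CrossingNumber.
Local Open Scope ring_scope.
Variable R : realFieldType.
Implicit Types (d : R) (u v w a b p q : R * R) (s t : seq (R * R)).

Definition nearby d : rel (R * R) :=
  fun u v => (`|u.1 - v.1| < d) && (`|u.2 - v.2| < d).

Lemma nearby_refl d u : 0 < d -> nearby d u u.
Proof. by move=> d_gt0; rewrite /nearby !subrr normr0 d_gt0. Qed.

Lemma nearby_sub2 d a a' b b' : nearby d a a' -> nearby d b b' ->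
  nearby (2 * d) (a - b) (a' - b').
Proof.
rewrite /nearby !ltr_norml.
move=> /andP[/andP[a1 a2] /andP[a3 a4]] /andP[/andP[b1 b2] /andP[b3 b4]].
by apply/andP; split; apply/andP; split=> /=; lra.
Qed.

(** The half-plane of arguments in [0, pi); the half-axis chosen at height 0
    makes exactly one of u and - u upper, for every nonzero u. *)
Definition upper u : bool := (0 < u.2) || (u.2 == 0) && (0 < u.1).

(** The signed number of crossings of the negative horizontal half-axis by a step
    from u to v that is short compared with the distance of u from 0: such a step
    changes half-planes either entirely at negative or entirely at positive
    abscissae, so the sign of the abscissa of u decides. *)
Definition cross u v : int :=
  if u.1 < 0 then (upper v)%:Z - (upper u)%:Z else 0.

Lemma upper_pos u : 0 < u.2 -> upper u.
Proof. by rewrite /upper => ->. Qed.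

Lemma upper_neg u : u.2 < 0 -> upper u = false.
Proof. by rewrite /upper; case: ltrgt0P. Qed.

(** In a ball that is far from 0, either all abscissae have the same sign or no
    point changes half-planes; hence [cross] is there the coboundary of a
    function, namely [upper] or 0. *)
Lemma cross_local d w u v : ~~ nearby (2 * d) w 0 ->
  nearby (2 * d) w u -> nearby (2 * d) w v ->
  cross u v = if w.1 < 0 then (upper v)%:Z - (upper u)%:Z else 0.
Proof.
rewrite /nearby /= !subr0 negb_and -!leNgt !ltr_norml.
case/orP; rewrite ler_normr => /orP[] far_w /andP[/andP[u1 u2] /andP[u3 u4]]
  /andP[/andP[v1 v2] /andP[v3 v4]]; rewrite /cross.
- have [w0 u0] : 0 <= w.1 /\ 0 <= u.1 by split; lra.
  by rewrite !ltNge w0 u0.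
- have [w0 u0] : w.1 < 0 /\ u.1 < 0 by split; lra.
  by rewrite w0 u0.
- have [v0 u0] : 0 < v.2 /\ 0 < u.2 by split; lra.
  by rewrite !upper_pos // subrr !if_same.
have [v0 u0] : v.2 < 0 /\ u.2 < 0 by split; lra.
by rewrite !upper_neg // subrr !if_same.
Qed.

Lemma upperN u : u != 0 -> upper (- u) = ~~ upper u.
Proof.
case: u => x y; rewrite /upper /= -pair_eqE /pair_eq /= !oppr_gt0 oppr_eq0.
by case: (ltrgtP y 0) => //= _; case: (ltrgtP x 0).
Qed.

(** A step crosses the horizontal axis either on the negative side or on the
    positive one; after the half-turn u -> - u, the latter crossings are those of
    the negative side. *)
Lemma crossN d u v : ~~ nearby (2 * d) u 0 -> nearby (2 * d) u v ->
  cross u v - cross (- u) (- v) = (upper v)%:Z - (upper u)%:Z.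
Proof.
move=> far_u uv.
have v0 : v != 0 by apply: contraNneq far_u => <-.
have d_gt0 : 0 < 2 * d by case/andP: uv => /(le_lt_trans (normr_ge0 _)).
have u0 : u != 0.
  by apply: contraNneq far_u => ->; rewrite /nearby !subrr normr0 d_gt0.
rewrite /cross !upperN //= oppr_lt0.
case: (ltrgtP u.1 0) => [_|_|u10]; [by rewrite subr0|lia|].
suff -> : upper u = upper v by rewrite !subrr.
move: far_u uv; rewrite /nearby /= u10 !subr0 normr0 d_gt0 /= sub0r -leNgt.
rewrite ler_normr !ltr_norml => /orP[] u2 /andP[_ /andP[v1 v2]].
  by rewrite !upper_pos //; lra.
by rewrite !upper_neg //; lra.
Qed.

(** One cell of the grid (a_s - b_t): its boundary lies in a ball far from 0,
    so the crossings cancel by [cross_local]. *)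
Lemma cross_square d a a' b b' : ~~ nearby (2 * d) a b ->
  nearby d a a' -> nearby d b b' ->
  cross (a - b) (a' - b) + cross (a' - b) (a' - b') =
  cross (a - b) (a - b') + cross (a - b') (a' - b').
Proof.
move=> far_ab aa' bb'.
have d_gt0 : 0 < d by case/andP: aa' => /(le_lt_trans (normr_ge0 _)).
have far_w : ~~ nearby (2 * d) (a - b) 0 by move: far_ab; rewrite /nearby /= !subr0.
have w1 : nearby (2 * d) (a - b) (a - b) by rewrite nearby_refl ?mulr_gt0.
have w2 : nearby (2 * d) (a - b) (a' - b) by rewrite nearby_sub2 ?nearby_refl.
have w3 : nearby (2 * d) (a - b) (a - b') by rewrite nearby_sub2 ?nearby_refl.
have w4 : nearby (2 * d) (a - b) (a' - b') by rewrite nearby_sub2.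
rewrite (cross_local far_w w1 w2) (cross_local far_w w2 w4).
rewrite (cross_local far_w w1 w3) (cross_local far_w w3 w4).
by case: ifP => // _; ring.
Qed.

(** The signed number of times the chain a :: s crosses the half-line that leaves
    q to the left; up to sign, this is a winding number if the chain is closed. *)
Fixpoint wind q a s : int :=
  if s is b :: s' then cross (a - q) (b - q) + wind q b s' else 0.

(** The chain - b :: - t, watched from - a, runs through the differences a - y
    with y in b :: t. *)
Lemma wind_strip d a a' b t : nearby d a a' -> path (nearby d) b t ->
  {in b :: t, forall y, ~~ nearby (2 * d) a y} ->
  wind (- a) (- b) (map -%R t) + cross (a - last b t) (a' - last b t) =
  cross (a - b) (a' - b) + wind (- a') (- b) (map -%R t).
Proof.
move=> aa'; elim: t b => [|b' t IH] b /=; first by rewrite add0r addr0.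
case/andP=> bb' b't far_t.
have {}IH := IH b' b't (fun y yt => far_t y (mem_tail b yt)).
have := cross_square (far_t b (mem_head _ _)) aa' bb'.
have opp_sub (x y : R * R) : - x - - y = y - x by rewrite opprK addrC.
by move=> E; rewrite !opp_sub -addrA IH addrA -E addrA.
Qed.

Lemma wind_grid d a s b t : path (nearby d) a s -> path (nearby d) b t ->
  {in a :: s & b :: t, forall x y, ~~ nearby (2 * d) x y} ->
  wind (- a) (- b) (map -%R t) + wind (last b t) a s =
  wind b a s + wind (- last a s) (- b) (map -%R t).
Proof.
move=> + bt; elim: s a => [|a' s IH] a /=; first by rewrite addr0 add0r.
case/andP=> aa' a's far_st.
have {}IH := IH a' a's (fun x y xs => far_st x y (mem_tail a xs)).
have strip := wind_strip aa' bt (fun y => far_st a y (mem_head _ _)).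
by rewrite addrA strip -addrA IH addrA.
Qed.

Lemma wind_opp d q b t : path (nearby d) b t ->
  {in b :: t, forall y, ~~ nearby (2 * d) q y} ->
  wind (- q) (- b) (map -%R t) =
  wind q b t - (upper (last b t - q))%:Z + (upper (b - q))%:Z.
Proof.
elim: t b => [|b' t IH] b /=; first by rewrite sub0r addrC subrr.
case/andP=> bb' b't far_t.
rewrite (IH b' b't (fun y yt => far_t y (mem_tail b yt))).
have /(@crossN d) : ~~ nearby (2 * d) (b - q) 0.
  have := far_t b (mem_head _ _).
  by rewrite /nearby /= !subr0 !(distrC q.1) !(distrC q.2).
have d_gt0 : 0 < d by case/andP: bb' => /(le_lt_trans (normr_ge0 _)).
move=> /(_ (b' - q) (nearby_sub2 bb' (nearby_refl q d_gt0))); rewrite !opprB.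
have opp_sub (x y : R * R) : - x - - y = y - x by rewrite opprK addrC.
move=> E; rewrite !opp_sub.
rewrite -[cross (q - b) _](subKr (cross (b - q) (b' - q))) E; ring.
Qed.

(** The boundary of the whole grid has winding number 0.  Its four sides are the
    chain a :: s seen from the two ends of b :: t and the chain b :: t seen from
    the two ends of a :: s; looking at b - a instead of a - b on the latter two
    costs the terms in [upper], by [wind_opp]. *)
Lemma wind_disjoint d a s b t : path (nearby d) a s -> path (nearby d) b t ->
  {in a :: s & b :: t, forall x y, ~~ nearby (2 * d) x y} ->
  wind b a s - wind (last b t) a s + (wind (last a s) b t - wind a b t)
  = (upper (last b t - last a s))%:Z - (upper (b - last a s))%:Z
    - (upper (last b t - a))%:Z + (upper (b - a))%:Z.
Proof.
move=> as_ bt far_st; have := wind_grid as_ bt far_st.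
rewrite (wind_opp bt (fun y => far_st a y (mem_head _ _))).
rewrite (wind_opp bt (fun y => far_st _ y (mem_last _ _))) => E.
lra.
Qed.


(** Among the fifteen equations, the number W k i j of turns of the edge ij around p_k
    occurs twice,
    in the pairs formed by ij with the two edges that join k to a vertex other
    than i and j.  The terms U i k = upper (p_i - p_k) occur six times in
    all, and with U i k + U k i = 1 they leave one odd constant for each pair of
    interleaved edges, that is, one for each set of four vertices: five in
    total. *)
Theorem no_K5_chains d (p : nat -> R * R) (s : nat -> nat -> seq (R * R)) :
  0 < d ->
  (forall i j, (i < j < 5)%N -> path (nearby d) (p i) (s i j)) ->
  (forall i j, (i < j < 5)%N -> last (p i) (s i j) = p j) ->
  (forall i j k l, (i < j < 5)%N -> (k < l < 5)%N -> uniq [:: i; j; k; l] ->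
    {in p i :: s i j & p k :: s k l, forall x y, ~~ nearby (2 * d) x y}) ->
  False.
Proof.
move=> d_gt0 chain_s last_s far_s.
pose U i j : int := upper (p i - p j); pose W k i j := wind (p k) (p i) (s i j).
have windE i j k l : (i < j < 5)%N -> (k < l < 5)%N -> uniq [:: i; j; k; l] ->
  W k i j - W l i j + (W j k l - W i k l) = U l j - U k j - U l i + U k i.
  move=> ij kl ijkl; have far_ijkl := far_s i j k l ij kl ijkl.
  have := wind_disjoint (chain_s i j ij) (chain_s k l kl) far_ijkl.
  by rewrite !last_s.
have U_sym i j k l : (i < j < 5)%N -> (k < l < 5)%N -> uniq [:: i; j; k; l] ->
  [/\ U i k + U k i = 1, U i l + U l i = 1, U j k + U k j = 1
    & U j l + U l j = 1].
  move=> ij kl ijkl; have far_ijkl := far_s i j k l ij kl ijkl.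
  have U1 x y : x \in p i :: s i j -> y \in p k :: s k l ->
      (upper (x - y))%:Z + (upper (y - x))%:Z = 1.
    move=> xs ys; rewrite -(opprB x y) upperN; first by case: upper.
    have := far_ijkl x y xs ys; rewrite subr_eq0.
    by apply: contraNneq => ->; rewrite nearby_refl ?mulr_gt0.
  have pk := mem_last (p k) (s k l); have pi := mem_last (p i) (s i j).
  by rewrite !last_s // in pk pi; split; apply: U1; rewrite ?mem_head.
have [u02 u03 u12 u13] := U_sym 0 1 2 3 isT isT isT.
have [u01 u04 _ u24] := U_sym 0 2 1 4 isT isT isT.
have [_ _ _ u34] := U_sym 0 3 1 4 isT isT isT.
have [_ _ _ u14] := U_sym 0 1 2 4 isT isT isT.
have [_ _ _ u23] := U_sym 0 2 1 3 isT isT isT.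
have e0 := windE 0 1 2 3 isT isT isT.
have e1 := windE 0 2 1 3 isT isT isT.
have e2 := windE 0 3 1 2 isT isT isT.
have e3 := windE 0 1 2 4 isT isT isT.
have e4 := windE 0 2 1 4 isT isT isT.
have e5 := windE 0 4 1 2 isT isT isT.
have e6 := windE 0 1 3 4 isT isT isT.
have e7 := windE 0 3 1 4 isT isT isT.
have e8 := windE 0 4 1 3 isT isT isT.
have e9 := windE 0 2 3 4 isT isT isT.
have e10 := windE 0 3 2 4 isT isT isT.
have e11 := windE 0 4 2 3 isT isT isT.
have e12 := windE 1 2 3 4 isT isT isT.
have e13 := windE 1 3 2 4 isT isT isT.
have e14 := windE 1 4 2 3 isT isT isT.
(* A linear system over the integers without solution modulo 2. *)
clearbody U W; clear -u01 u02 u03 u04 u12 u13 u14 u23 u24 u34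
  e0 e1 e2 e3 e4 e5 e6 e7 e8 e9 e10 e11 e12 e13 e14.
lia.
Qed.
End CrossingNumber.

(** * Chains of points on arcs *)

Section Arcs.
Local Open Scope classical_set_scope.
Local Open Scope ring_scope.
Variable R : realType.
Implicit Types (d : R) (p q : R * R) (A B : set (R * R)).

Lemma nearbyE d p q : nearby d p q <-> ball p d q.
Proof.
rewrite /nearby /ball /= /prod_ball /ball /=; split=> [/andP[]//|[? ?]].
by apply/andP.
Qed.

Lemma nearby_norm d p q : nearby d p q = (`|p - q| < d).
Proof. by rewrite prod_normE gt_max. Qed.

Lemma plane_arc_compact p q A : plane_arc p q A -> compact A.
Proof.
by case=> f [fc _ _ _ <-]; apply: continuous_compact (@segment_compact _ _ _).
Qed.

Lemma plane_arc_connected p q A : plane_arc p q A -> connected A.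
Proof.
by case=> f [fc _ _ _ <-]; apply: connected_continuous_connected fc;
  exact: segment_connected.
Qed.

Lemma plane_arc_ends p q A : plane_arc p q A -> A p /\ A q.
Proof.
case=> f [_ _ <- <- <-]; split; [exists 0 | exists 1] => //=;
  by rewrite in_itv /= lexx ler01.
Qed.

(** A discrete path in A with steps shorter than d. *)
Definition dchain d A p q := exists s,
  [/\ path (nearby d) p s, last p s = q & forall z, z \in p :: s -> A z].

Lemma dchain_trans d A p q r : dchain d A p q -> dchain d A q r -> dchain d A p r.
Proof.
move=> [s [ps sq sA]] [t [qt tr tA]]; exists (s ++ t).
rewrite cat_path last_cat ps sq; split=> // z.
by rewrite -cat_cons mem_cat => /orP[/sA//|zt]; apply: tA; rewrite in_cons zt orbT.
Qed.

Lemma sub_dchain d A B p q : A `<=` B -> dchain d A p q -> dchain d B p q.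
Proof. by move=> AB [s [? ? sA]]; exists s; split=> // z /sA /AB. Qed.

(** The points of A within reach of p form an open and closed part of A. *)
Lemma connected_dchain d A p q : 0 < d -> connected A -> A p -> A q ->
  dchain d A p q.
Proof.
move=> d_gt0 conA Ap Aq.
pose B := A `&` [set z | dchain d A p z].
have step z w : dchain d A p z -> A w -> nearby d z w -> dchain d A p w.
  move=> pz Aw zw; apply: (dchain_trans pz); exists [:: w]; rewrite /= zw.
  split=> // y; rewrite !inE => /orP[]/eqP-> //.
  by case: pz => s [_ <- sA]; exact/sA/mem_last.
have BA : B = A; last first.
  have [_ pq] : B q by rewrite BA; exact: Aq.
  exact: pq.
apply: conA.
- exists p; split=> //; exists [::]; split=> // z.
  by rewrite inE => /eqP->.
- exists (\bigcup_(z in B) (ball z d)).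
    by apply: bigcup_open => z _; exact: ball_open.
  apply/seteqP; split=> z [Az Bz]; split=> //.
    by exists z => //; apply: ballxx.
  by case: Bz => w [Aw pw] /nearbyE wz; exact: step pw Az wz.
exists (~` \bigcup_(z in A `\` B) (ball z d)).
  by apply: open_closedC; apply: bigcup_open => z _; exact: ball_open.
apply/seteqP; split=> z [Az Bz]; split=> //.
  case=> w [Aw nBw] /ball_sym/nearbyE zw; apply: nBw; split=> //.
  exact: step Bz Aw zw.
apply: contrapT => pz; apply: Bz; exists z; last exact: ballxx.
by split=> // -[].
Qed.

Lemma compact_apart A B : compact A -> compact B -> A `&` B = set0 ->
  exists2 d, 0 < d & forall p q, A p -> B q -> ~~ nearby d p q.
Proof.
move=> cA cB AB0; have [[x AxB]|nAB] := pselect (A `*` B !=set0); last first.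
  by exists 1 => // p q Ap Bq; case: nAB; exists (p, q).
have cf : continuous (fun z : (R * R) * (R * R) => `|z.1 - z.2|).
  move=> z; apply: (@cvg_comp _ _ _ (fun z => z.1 - z.2) (fun z => `|z|)).
    by apply: cvgB; [exact: cvg_fst|exact: cvg_snd].
  exact: norm_continuous.
have [|[a b]] := compact_EVT_min _ (compact_setX cA cB) (continuous_subspaceT cf).
  by exists x.
rewrite inE => -[/= Aa Bb] min_ab; exists `|a - b|.
  rewrite normr_gt0 subr_eq0; apply/eqP => ab.
  have : (A `&` B) a by split=> //; rewrite ab.
  by rewrite AB0.
move=> p q Ap Bq; rewrite nearby_norm -leNgt.
by apply: (min_ab (p, q)); rewrite inE.
Qed.

End Arcs.

(** * Subdivisions of K5 are not planar *)

Section Kuratowski.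
Local Open Scope classical_set_scope.
Local Open Scope ring_scope.
Variable R : realType.

Lemma uniform_gt0 (T : finType) (P : T -> R -> Prop) :
  (forall t e d, e <= d -> P t d -> P t e) ->
  (forall t, exists2 d, 0 < d & P t d) ->
  exists2 d, 0 < d & forall t, P t d.
Proof.
move=> Pmono exP.
have /choice[f fP] t : exists d, 0 < d /\ P t d.
  by have [d ? ?] := exP t; exists d.
exists (\big[Num.min/1]_t f t).
  by apply/bigmin_gtP; split=> // t _; case: (fP t).
by move=> t; apply: Pmono (proj2 (fP t)); exact: bigmin_le_cond.
Qed.

Lemma nearbyW (e d : R) p q : e <= d -> nearby e p q -> nearby d p q.
Proof. by rewrite !nearby_norm => ed /lt_le_trans; apply. Qed.

Definition induced_rel (G : sgraph) (W : pred G) : rel G :=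
  fun x y => [&& adj x y, W x & W y].

Definition drawn (G : sgraph) (A : G -> G -> set (R * R)) (W : pred G) :=
  [set p | exists x y, induced_rel W x y /\ A x y p].

(** Chains along the successive arcs of a walk are concatenated; x != y ensures
    that there is at least one arc, which then contains the starting point. *)
Lemma connect_dchain (G : sgraph) pt A (W : pred G) d x y : 0 < d ->
  plane_drawing pt A -> x != y -> connect (induced_rel W) x y ->
  dchain d (drawn A W) (pt x) (pt y).
Proof.
move=> d_gt0 [_ _ arcA _ _] xy /connectP[s xs ey].
elim: s x xs ey xy => [|z s IH] x /= xs ey xy; first by rewrite ey eqxx in xy.
case/andP: xs => xz zs.
have xzP : dchain d (drawn A W) (pt x) (pt z).
  have /and3P[/arcA arc_xz _ _] := xz.
  apply: (@sub_dchain _ _ (A x z)); first by move=> p Ap; exists x, z.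
  have [] := plane_arc_ends arc_xz.
  exact/connected_dchain/(plane_arc_connected arc_xz).
by have [<-//|zy] := eqVneq z y; exact: dchain_trans xzP (IH z zs ey zy).
Qed.

(** There are finitely many pairs of disjoint edges, and their arcs are disjoint
    compact sets. *)
Lemma plane_drawing_apart (G : sgraph) pt A : @plane_drawing R G pt A ->
  exists2 d, 0 < d & forall x y u v, adj x y -> adj u v ->
    [&& x != u, x != v, y != u & y != v] ->
    forall p q, A x y p -> A u v q -> ~~ nearby d p q.
Proof.
case=> pt_inj _ arcA _ disjA.
pose P (t : G * G * (G * G)) d := adj t.1.1 t.1.2 -> adj t.2.1 t.2.2 ->
  [&& t.1.1 != t.2.1, t.1.1 != t.2.2, t.1.2 != t.2.1 & t.1.2 != t.2.2] ->
  forall p q, A t.1.1 t.1.2 p -> A t.2.1 t.2.2 q -> ~~ nearby d p q.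
have [||d d_gt0 dP] := @uniform_gt0 _ P; last first.
- by exists d => // x y u v; exact: (dP ((x, y), (u, v))).
- case=> -[x y] [u v]; rewrite /P /=.
  have [xy|] := boolP (adj x y); last by exists 1.
  have [uv|] := boolP (adj u v); last by exists 1.
  have [dis|] := boolP [&& x != u, x != v, y != u & y != v]; last by exists 1.
  have [|||d d_gt0 dP] := @compact_apart _ (A x y) (A u v).
  + exact: plane_arc_compact (arcA _ _ xy).
  + exact: plane_arc_compact (arcA _ _ uv).
  + apply/seteqP; split=> // p [Axy Auv].
    have xy_uv : [set x; y]%SET != [set u; v]%SET.
      apply: contraTneq dis => e; have := set21 x y.
      by rewrite e !inE !negb_and !negbK => /orP[]->; rewrite ?orbT.
    have uv_xy : [set u; v]%SET != [set x; y]%SET by rewrite eq_sym.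
    have := disjA x y u v xy uv xy_uv p (conj Axy Auv).
    have := disjA u v x y uv xy uv_xy p (conj Auv Axy).
    case/and4P: dis => /eqP xu /eqP xv /eqP yu /eqP yv.
    by move=> [] -> [] /pt_inj/esym.
  by exists d.
move=> t e d ed Pt xy uv dis p q Ap Aq.
by apply: contra (Pt xy uv dis p q Ap Aq); exact: nearbyW.
Qed.

(** W i j is the vertex set of the path that replaces the edge ij of K5. *)
Theorem K5_subdivision_nonplanar (G : sgraph) (b : nat -> G)
    (W : nat -> nat -> pred G) :
  (forall i j, (i < j < 5)%N -> b i != b j) ->
  (forall i j, (i < j < 5)%N -> connect (induced_rel (W i j)) (b i) (b j)) ->
  (forall i j k l, (i < j < 5)%N -> (k < l < 5)%N -> uniq [:: i; j; k; l] ->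
    forall x, W i j x -> ~~ W k l x) ->
  ~ planar R G.
Proof.
move=> b_neq b_con W_dis [pt [A draw]].
have [d d_gt0 apart] := plane_drawing_apart draw.
have d2_gt0 : 0 < d / 2 by rewrite divr_gt0.
have /choice[s sP] (ij : nat * nat) : exists s, (ij.1 < ij.2 < 5)%N ->
    [/\ path (nearby (d / 2)) (pt (b ij.1)) s,
        last (pt (b ij.1)) s = pt (b ij.2) &
        forall z, z \in pt (b ij.1) :: s -> drawn A (W ij.1 ij.2) z].
  have [lt_ij|] := boolP (ij.1 < ij.2 < 5)%N; last by exists [::].
  have [s sP] := connect_dchain d2_gt0 draw (b_neq _ _ lt_ij) (b_con _ _ lt_ij).
  by exists s.
apply: (@no_K5_chains _ (d / 2) (pt \o b) (fun i j => s (i, j)) d2_gt0).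
- by move=> i j /(sP (i, j))[].
- by move=> i j /(sP (i, j))[].
move=> i j k l ij kl ijkl p q.
have [_ _ /(_ p)/=sp] := sP (i, j) ij; have [_ _ /(_ q)/=sq] := sP (k, l) kl.
move=> /sp[x [y [/and3P[xy Wx Wy] Ap]]] /sq[u [v [/and3P[uv Wu Wv] Aq]]].
rewrite mulrC divfK ?pnatr_eq0 //; apply: apart Ap Aq => //.
have neq z w : W i j z -> W k l w -> z != w.
  by move=> Wz Ww; apply: contraTneq Ww => <-; apply: W_dis Wz.
by rewrite !neq.
Qed.

End Kuratowski.

(** * Degree monotone paths and colourings *)

Section Degrees.
Variable G : sgraph.
Implicit Types (x y : G) (s : seq G).

Lemma deg_le x s : (forall y, adj x y -> y \in s) -> deg x <= size s.
Proof.
move=> sub; apply: leq_trans (card_size s); apply: subset_leq_card.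
by apply/fintype.subsetP => y; rewrite inE => /sub.
Qed.

Lemma deg_ge x s : uniq s -> {in s, forall y, adj x y} -> size s <= deg x.
Proof.
move=> /card_uniqP<- sub; apply: subset_leq_card.
by apply/fintype.subsetP => y /sub; rewrite inE.
Qed.

(** Up to reversal, degree monotone paths are the paths of this relation. *)
Definition climb : rel G := fun x y => adj x y && (deg x <= deg y).

Lemma degree_monotone_climb s : degree_monotone_path s ->
  exists t, [/\ size t = size s, uniq t & sorted climb t].
Proof.
have sorted_climb t : sorted (@adj G) t -> sorted leq (map (@deg G) t) ->
    sorted climb t.
  elim: t => // x [|y t] IH //= /andP[xy yt] /andP[dxy dyt].
  by rewrite /climb xy dxy; exact: IH.
case/and3P=> us adj_s /orP[up|down]; first by exists s; split=> //; exact: sorted_climb.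
exists (rev s); rewrite size_rev rev_uniq; split=> //; apply: sorted_climb.
  by rewrite rev_sorted; apply: sub_sorted adj_s => x y; rewrite adj_sym.
by rewrite map_rev rev_sorted.
Qed.

Lemma mp_eqP k : (exists2 s, size s = k & degree_monotone_path (G := G) s) ->
  (forall s : seq G, degree_monotone_path s -> size s <= k) -> mp G = k.
Proof.
move=> [s sk mon_s] le_k; apply/eqP; rewrite eqn_leq; apply/andP; split.
  by apply/bigmax_leqP => i /existsP[t /le_k]; rewrite size_tuple.
have k_card : k < #|G|.+1.
  by rewrite ltnS -sk -(card_uniqP _) ?max_card //; case/and3P: mon_s.
apply: (@leq_bigmax_cond _ _ (fun i : 'I_#|G|.+1 => i : nat) (Ordinal k_card)).
by apply/existsP; exists (tcast sk (in_tuple s)); rewrite val_tcast.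
Qed.

Lemma chromatic_number_eqP k : colorable G k -> (forall l, colorable G l -> k <= l) ->
  chromatic_number G = k.
Proof.
move=> col_k min_k; rewrite /chromatic_number; case: ex_minnP => l col_l min_l.
by apply/eqP; rewrite eqn_leq min_l // min_k.
Qed.

Lemma clique_colorable s l : uniq s ->
  {in s &, forall x y, x != y -> adj x y} -> colorable G l -> size s <= l.
Proof.
move=> us cl /existsP[c /forallP col].
have inj_c : {in s &, injective c}.
  move=> x y xs ys /eqP; apply: contraTeq => xy.
  by have /forallP/(_ y)/implyP := col x; apply; exact: cl.
rewrite -(size_map c) -(card_uniqP _) ?map_inj_in_uniq //.
by rewrite -[l in _ <= l]card_ord max_card.
Qed.

End Degrees.

(** * The capped bipyramid *)

Section CappedBipyramid.
Variable n : nat.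

(** The rim has length 3 * n.+2; its last index is 3 * n + 5. *)
Definition vtx : finType := ('I_(3 * n + 5).+1 + ('I_n.+2 + bool))%type.
Definition Rim i : vtx := inl i.
Definition Cap j : vtx := inr (inl j).
Definition Pole b : vtx := inr (inr b).
(** For t > 3 * n + 5 this is rim vertex 0, by the default value of [inord]. *)
Definition rim (t : nat) : vtx := Rim (inord t).

Definition cyc (i j : nat) : bool :=
  [|| j == i.+1, i == j.+1, (i == 0) && (j == 3 * n + 5)
    | (j == 0) && (i == 3 * n + 5)].

Definition under (i j : nat) : bool := (i == 3 * j + 1) || (i == 3 * j + 2).

Definition cb_adj : rel vtx := fun x y =>
  match x, y with
  | inl i, inl j => cyc i j
  | inl i, inr (inl j) | inr (inl j), inl i => under i j
  | inl _, inr (inr _) | inr (inr _), inl _ => true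
  | inr (inl _), inr (inr b) | inr (inr b), inr (inl _) => b
  | _, _ => false
  end.

Lemma cb_adj_sym : symmetric cb_adj.
Proof. by case=> [i|[j|b]] [i'|[j'|b']] //=; rewrite /cyc; lia. Qed.

Lemma cb_adj_irr : irreflexive cb_adj.
Proof. by case=> [i|[j|b]] //=; rewrite /cyc; lia. Qed.

Definition capped_bipyramid : sgraph := SGraph cb_adj_sym cb_adj_irr.

Lemma Rim_rim i : Rim i = rim i.
Proof. by rewrite /rim inord_val. Qed.

Lemma deg_cap j : deg (Cap j : capped_bipyramid) <= 3.
Proof.
apply: (@deg_le capped_bipyramid _ [:: Pole true; rim (3 * j + 1); rim (3 * j + 2)]).
case=> [i|[j'|[]]] //=; rewrite -/(Rim i) Rim_rim.
by case/orP => /eqP->; rewrite !inE eqxx ?orbT.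
Qed.

Lemma deg_rim3 (i : 'I_(3 * n + 5).+1) : i %% 3 = 0 -> 
  deg (Rim i : capped_bipyramid) <= 4.
Proof.
move=> i3; have ltI := ltn_ord i.
apply: (@deg_le capped_bipyramid _ [:: Pole true; Pole false;
  rim (if i == 0 :> nat then 3 * n + 5 else i.-1); rim i.+1]).
case=> [j|[j|[]]] //=; last by rewrite /under; lia.
rewrite -/(Rim j) Rim_rim => ij; have ltJ := ltn_ord j; move: ij.
rewrite !in_cons; case: (i =P 0 :> nat) => i0 ij.
- suff [->|->] : j = 3 * n + 5 :> nat \/ j = i.+1 :> nat by rewrite eqxx ?orbT.
    by rewrite /cyc in ij; lia.
- suff [->|->] : j = i.-1 :> nat \/ j = i.+1 :> nat by rewrite eqxx ?orbT.
    by rewrite /cyc in ij; lia.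
Qed.

Lemma deg_rim (i : 'I_(3 * n + 5).+1) : i %% 3 != 0 -> deg (Rim i : capped_bipyramid) = 5.
Proof.
move=> i3; have ltI := ltn_ord i.
pose s : seq vtx := [:: Pole true; Pole false; Cap (inord (i %/ 3));
  rim i.-1; rim (if i == 3 * n + 5 :> nat then 0 else i.+1)].
have Ki : i %/ 3 < n.+2 by lia.
apply/eqP; rewrite eqn_leq; apply/andP; split.
  apply: (@deg_le capped_bipyramid _ s).
  case=> [j|[j|[]]] //=.
    rewrite -/(Rim j) Rim_rim => ij; have ltJ := ltn_ord j; move: ij.
    rewrite !in_cons; case: (i =P 3 * n + 5 :> nat) => i0 ij.
    - suff [->|->] : j = i.-1 :> nat \/ j = 0 :> nat by rewrite eqxx ?orbT.
    by rewrite /cyc in ij; lia.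
    - suff [->|->] : j = i.-1 :> nat \/ j = i.+1 :> nat by rewrite eqxx ?orbT.
    by rewrite /cyc in ij; lia.
  rewrite /under /s => ij; have <- : j = i %/ 3 :> nat by lia.
  by rewrite inord_val !in_cons eqxx !orbT.
apply: (@deg_ge capped_bipyramid _ s) => /=.
  rewrite !inE /= !andbT; apply/eqP => -[] /(congr1 val).
  by case: ifP => /eqP ?; rewrite /= !inordK; lia.
move=> y; rewrite !in_cons in_nil orbF => /or4P[/eqP->|/eqP->|/eqP->|] //=.
  by rewrite inordK // /under; lia.
case/orP => /eqP-> /=; first by rewrite /cyc inordK; lia.
by rewrite /cyc; case: ifP => /eqP ?; rewrite inordK; lia.
Qed.

Lemma deg_pole b : 6 <= deg (Pole b : capped_bipyramid).
Proof.
apply: (@deg_ge capped_bipyramid _ (map rim (iota 0 6))); last by move=> y /mapP[t _ ->].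
rewrite map_inj_in_uniq ?iota_uniq // => t u; rewrite !mem_iota /= => lt lu.
by case=> /(congr1 val); rewrite /= !inordK; lia.
Qed.

Lemma climb_pole b x : @climb capped_bipyramid (Pole b) x = false.
Proof.
apply/andP => -[]; have := deg_pole b; case: x => [i|[j|b']] //= dP _.
  rewrite leqNgt (leq_trans _ dP) // ltnS.
  by have [/eqP/deg_rim3/leqW|/deg_rim->] := boolP (i %% 3 == 0).
by rewrite leqNgt (leq_ltn_trans (deg_cap j)) // (leq_trans _ dP).
Qed.

Lemma climb_cap x j : @climb capped_bipyramid x (Cap j) = false.
Proof.
case: x => [i|[j'|b]]; rewrite ?climb_pole //; apply/andP => -[] //= ij.
have i3 : i %% 3 != 0 by move: ij; rewrite /under; lia.
by rewrite leqNgt (leq_ltn_trans (deg_cap j)) // deg_rim.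
Qed.

Lemma climb_rim x (j : 'I_(3 * n + 5).+1) : 
  @climb capped_bipyramid x (Rim j) -> j %% 3 != 0.
Proof.
case: x => [i|[j'|b]]; rewrite ?climb_pole //=; case/andP => /= ij; last first.
  by move=> _; move: ij; rewrite /under; lia.
apply: contraTneq => j3; have i3 : i %% 3 != 0.
  by have := ltn_ord i; have := ltn_ord j; move: ij; rewrite /cyc; lia.
by rewrite -ltnNge (leq_ltn_trans (deg_rim3 j3)) // deg_rim.
Qed.

(** By [climb_cap], [climb_rim] and [climb_pole], the second, third and fourth
    vertices are on the rim at indices that are not multiples of 3; but among
    three consecutive indices there is a multiple of 3. *)
Lemma climb_size s : uniq s -> sorted (@climb capped_bipyramid) s -> size s <= 4.
Proof.
case: s => [|x1 [|x2 [|x3 [|x4 [|x5 s]]]]] //= us /and5P[c12 c23 c34 c45 _].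
exfalso; move: us c12 c23 c34 c45.
case: x2 => [i2|[j|b]]; rewrite ?climb_pole ?climb_cap //.
case: x3 => [i3|[j|b]]; rewrite ?climb_pole ?climb_cap //.
case: x4 => [i4|[j|b]]; rewrite ?climb_pole ?climb_cap //.
move=> us /climb_rim m2 c23 c34 _.
have m3 := climb_rim c23; have m4 := climb_rim c34.
have i24 : i2 != i4 :> nat.
  case/and5P: us => _ + _ _; rewrite !in_cons !negb_or => /and3P[_ /eqP i24 _] _.
  by apply/eqP => /val_inj e; apply: i24; rewrite e.
case/andP: c23 => /= a23 _; case/andP: c34 => /= a34 _.
have := (ltn_ord i2, ltn_ord i3, ltn_ord i4).
by move: a23 a34; rewrite /cyc => ? ? [[? ?] ?]; lia.
Qed.

Definition K4 : seq capped_bipyramid := [:: Cap ord0; rim 1; rim 2; Pole true].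

Lemma K4_uniq : uniq K4.
Proof.
rewrite /= !in_cons !in_nil /= !orbF ?andbT; apply/eqP => -[] /(congr1 val).
by rewrite /= !inordK; lia.
Qed.

Lemma K4_clique : {in K4 &, forall x y : capped_bipyramid, x != y -> adj x y}.
Proof.
have [v1 v2] : (inord 1 : 'I_(3 * n + 5).+1) = 1 :> nat /\
               (inord 2 : 'I_(3 * n + 5).+1) = 2 :> nat by rewrite !inordK; lia.
move=> x y; rewrite !in_cons !in_nil !orbF.
by case/or4P => /eqP->; case/or4P => /eqP->; rewrite ?eqxx //= ?v1 ?v2.
Qed.

Lemma chromatic_number_capped_bipyramid : chromatic_number capped_bipyramid = 4.
Proof.
apply: chromatic_number_eqP; last first.
  by move=> l; exact: clique_colorable K4_uniq K4_clique.
pose c (x : capped_bipyramid) : 'I_4 := inord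
  match x with inl i => i %% 3 | inr (inl _) => 0 | inr (inr _) => 3 end.
apply/existsP; exists [ffun x => c x]; apply/forallP => x; apply/forallP => y.
apply/implyP; rewrite !ffunE => xy; apply/eqP => /(congr1 val).
have lt_c (z : capped_bipyramid) : match z with
    inl i => i %% 3 | inr (inl _) => 0 | inr (inr _) => 3 end < 4.
  by case: z => [i|[j|b]] //; lia.
rewrite /= !inordK ?lt_c //.
case: x y xy => [i|[j|b]] [i'|[j'|b']] //=; rewrite /cyc /under; try lia.
Qed.

Lemma mp_capped_bipyramid : mp capped_bipyramid = 4.
Proof.
apply: mp_eqP; last first.
  by move=> s /degree_monotone_climb[t [<-]]; exact: climb_size.
have [v1 v2] : (inord 1 : 'I_(3 * n + 5).+1) = 1 :> nat /\
               (inord 2 : 'I_(3 * n + 5).+1) = 2 :> nat by rewrite !inordK; lia.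
exists K4 => //; rewrite /degree_monotone_path K4_uniq /= v1 v2 /= /rim.
rewrite !(@deg_rim (inord _)) ?v1 ?v2 //.
by rewrite (leq_trans (deg_cap _)) //= (leq_trans _ (deg_pole _)).
Qed.

Lemma card_capped_bipyramid : n <= #|capped_bipyramid|.
Proof. by rewrite !card_sum !card_ord card_bool; lia. Qed.

End CappedBipyramid.

(** * Subdivided K5 with four direct edges at one vertex *)

Section Hub.
Variables (R : realType) (G : sgraph).
Implicit Types (x y : G) (W Y A : pred G).

Definition joins W x y := connect (induced_rel W) x y.

Lemma joins_edge W x y : adj x y -> W x -> W y -> joins W x y.
Proof. by move=> xy Wx Wy; apply: connect1; apply/and3P. Qed.

Lemma joins_trans W y x z : joins W x y -> joins W y z -> joins W x z.
Proof. exact: connect_trans. Qed.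

Lemma joins_sym W x y : joins W x y = joins W y x.
Proof.
by apply: sym_connect_sym => u v; rewrite /induced_rel adj_sym [W u && _]andbC.
Qed.

(** The branch vertices are x, y and the three a's; Y_i joins y to a_i, and A_i
    joins the two a's other than a_i.  All edges at x being direct, independence
    amounts to three disjointness conditions and to branch vertices avoiding
    the paths they do not belong to.  This is the shape found around a vertex x
    of a triangulation: the a's lie on the cycle of its neighbours, and the new
    edge is xy. *)
Lemma K5_hub x y a1 a2 a3 Y1 Y2 Y3 A1 A2 A3 :
  uniq [:: x; y; a1; a2; a3] ->
  [/\ adj x y, adj x a1, adj x a2 & adj x a3] ->
  [/\ joins Y1 y a1, joins Y2 y a2 & joins Y3 y a3] ->
  [/\ joins A1 a2 a3, joins A2 a1 a3 & joins A3 a1 a2] ->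
  ~~ [|| Y1 x, Y2 x, Y3 x, A1 x, A2 x | A3 x] ->
  ~~ [|| A1 y, A2 y | A3 y] ->
  ~~ [|| Y2 a1, Y3 a1 | A1 a1] ->
  ~~ [|| Y1 a2, Y3 a2 | A2 a2] ->
  ~~ [|| Y1 a3, Y2 a3 | A3 a3] ->
  (forall z, [&& Y1 z ==> ~~ A1 z, Y2 z ==> ~~ A2 z & Y3 z ==> ~~ A3 z]) ->
  ~ planar R G.
Proof.
move=> us [xy xa1 xa2 xa3] [y1 y2 y3] [c1 c2 c3] nx ny n1 n2 n3 dis.
pose b := nth x [:: x; y; a1; a2; a3].
pose W i j : pred G := match i, j with
  | 1, 2 => Y1 | 1, 3 => Y2 | 1, 4 => Y3
  | 2, 3 => A3 | 2, 4 => A2 | 3, 4 => A1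
  | _, _ => pred2 (b i) (b j) end.
have direct v : adj x v -> connect (induced_rel (pred2 x v)) x v.
  by move=> xv; apply: joins_edge xv _ _; rewrite /= eqxx ?orbT.
apply: (@K5_subdivision_nonplanar R G b W).
- move=> i j /andP[ij j5]; rewrite nth_uniq ?neq_ltn ?ij //.
  exact: ltn_trans ij j5.
- by move=> [|[|[|[|i]]]] [|[|[|[|[|j]]]]]; rewrite ?andbF // => _;
    first [exact: direct | assumption].
have out (B : pred G) u v : ~~ B u -> ~~ B v -> forall z, pred2 u v z -> ~~ B z.
  by move=> Bu Bv z /= /orP[]/eqP->.
have out' (B : pred G) u v : ~~ B u -> ~~ B v -> forall z, B z -> ~~ pred2 u v z.
  by move=> Bu Bv z Bz; apply: contraL Bz => /out; apply.
have [d1 d2 d3] : [/\ forall z, Y1 z -> ~~ A1 z, forall z, Y2 z -> ~~ A2 z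
    & forall z, Y3 z -> ~~ A3 z].
  by split=> z; case/and3P: (dis z) => /implyP ? /implyP ? /implyP ?.
have flip (B C : pred G) : (forall z, B z -> ~~ C z) -> forall z, C z -> ~~ B z.
  by move=> BC z; apply: contraL => /BC.
move: nx ny n1 n2 n3; rewrite !negb_or.
move=> /and5P[? ? ? ? /andP[? ?]] /and3P[? ? ?] /and3P[? ? ?] /and3P[? ? ?].
move=> /and3P[? ? ?].
move=> [|[|[|[|i]]]] [|[|[|[|[|j]]]]] [|[|[|[|k]]]] [|[|[|[|[|l]]]]];
  rewrite ?andbF // => _ _ _;
  by [exact: out | exact: out' | assumption | exact: flip].
Qed.

End Hub.

(** * Adding an edge to the capped bipyramid *)

Section ExtraEdge.
Variables (R : realType) (n : nat) (e : rel (vtx n)).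
Hypotheses (e_sym : symmetric e) (e_irr : irreflexive e).
Hypothesis sub_e : subrel (@cb_adj n) e.
Notation H := (SGraph e_sym e_irr).
Notation K := (3 * n + 5).
Implicit Types (W : pred H) (P Q : pred nat) (T : pred bool).

(** Vertex sets of the subdivided edges, described separately on the rim, the caps
    and the poles, so that disjointness becomes arithmetic on indices. *)
Definition zone P Q T : pred (vtx n) := fun z =>
  match z with inl i => P i | inr (inl j) => Q j | inr (inr b) => T b end.

Lemma joins_sub W x y : cb_adj x y -> W x -> W y -> @joins H W x y.
Proof. by move=> xy; apply: joins_edge; exact: sub_e. Qed.

Lemma cb_adj_rim a : a < K -> cb_adj (rim n a) (rim n a.+1).
Proof. by move=> aK; rewrite /= /cyc !inordK ?eqxx //; lia. Qed.

Lemma cb_adj_rim0 : cb_adj (rim n K) (rim n 0).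
Proof. by rewrite /= /cyc !inordK //; lia. Qed.

Lemma joins_rims W a c : a <= c <= K -> (forall t, a <= t <= c -> W (rim n t)) ->
  @joins H W (rim n a) (rim n c).
Proof.
case/andP=> /subnKC <-; elim: (c - a) => [|d IH] adK Wt.
  by rewrite addn0; exact: connect0.
apply: (@joins_trans H _ (rim n (a + d))).
  by apply: IH => [|t t_ad]; [lia|apply: Wt; lia].
by rewrite addnS; apply: joins_sub; [apply: cb_adj_rim|apply: Wt|apply: Wt]; lia.
Qed.

(** The way around, through the edge from the last rim vertex to rim 0. *)
Lemma joins_wrap W a c : a <= c <= K ->
  (forall t, t <= a \/ c <= t <= K -> W (rim n t)) -> @joins H W (rim n a) (rim n c).
Proof.
move=> acK Wt; rewrite joins_sym; apply: (@joins_trans H _ (rim n K)).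
  by apply: joins_rims => [|t tc]; [lia|apply: Wt; lia].
apply: (@joins_trans H _ (rim n 0)).
  by apply: joins_sub cb_adj_rim0 _ _; apply: Wt; lia.
by apply: joins_rims => [|t ta]; [lia|apply: Wt; lia].
Qed.

Lemma eq_rim a c : a <= K -> c <= K -> (rim n a == rim n c) = (a == c).
Proof.
move=> aK cK; apply/eqP/eqP => [|->//].
by case=> /(congr1 val); rewrite /= !inordK.
Qed.

Lemma zone_rim P Q T a : a <= K -> zone P Q T (rim n a) = P a.
Proof. by move=> aK; rewrite /= inordK. Qed.

(** The rim is cut into a triangle on its vertices 0, 1 and 2. *)
Lemma poles_edge_nonplanar : e (Pole n true) (Pole n false) -> ~ planar R H.
Proof.
move=> ePP.
apply: (@K5_hub R H (Pole n true) (Pole n false) (rim n 0) (rim n 1) (rim n 2)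
  (zone (pred1 0) pred0 (pred1 false)) (zone (pred1 1) pred0 (pred1 false))
  (zone (pred1 2) pred0 (pred1 false)) (zone (pred2 1 2) pred0 pred0)
  (zone (fun t => t != 1) pred0 pred0) (zone (pred2 0 1) pred0 pred0)).
- by rewrite /= !in_cons !in_nil !eq_rim //=; lia.
- by split; rewrite /= ?ePP //; apply: sub_e.
- by split; apply: joins_sub; rewrite ?zone_rim //; lia.
- split.
  + by apply: joins_rims => [|t t12]; rewrite ?zone_rim /=; lia.
  + by apply: joins_wrap => [|t t12]; rewrite ?zone_rim /=; lia.
  + by apply: joins_rims => [|t t12]; rewrite ?zone_rim /=; lia.
- by rewrite /= .
- by rewrite /= .
- by rewrite !zone_rim /=; lia.
- by rewrite !zone_rim /=; lia.
- by rewrite !zone_rim /=; lia.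
by case=> [t|[j|b]]; rewrite /= ?implybT //; lia.
Qed.

(** The poles and rim a.+1 lie on the link of rim a.  They are joined to each other
    directly, except for the two poles, which are joined through a rim vertex z
    outside of the interval [a, c]. *)
Lemma rims_edge_nonplanar a c : a < c <= K -> ~~ cyc n a c ->
  e (rim n a) (rim n c) -> ~ planar R H.
Proof.
move=> acK nac eac.
have [z zac zK] : exists2 z, (z < a) || (c < z) & z <= K.
  by move: nac; rewrite /cyc; case: (posnP a) => a0 nac; [exists K|exists 0]; lia.
have ac : a.+1 < c by move: nac; rewrite /cyc; lia.
apply: (@K5_hub R H (rim n a) (rim n c) (Pole n true) (Pole n false) (rim n a.+1)
  (zone (pred1 c) pred0 (pred1 true)) (zone (pred1 c) pred0 (pred1 false))
  (zone (fun t => a < t <= c) pred0 pred0)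
  (zone (pred1 a.+1) pred0 (pred1 false)) (zone (pred1 a.+1) pred0 (pred1 true))
  (zone (pred1 z) pred0 predT)).
- by rewrite /= !in_cons !in_nil !eq_rim //=; lia.
- split=> //; apply: sub_e => //; apply: cb_adj_rim; lia.
- split.
  + by apply: joins_sub; rewrite ?zone_rim //=; lia.
  + by apply: joins_sub; rewrite ?zone_rim //=; lia.
  + by rewrite joins_sym; apply: joins_rims => [|t t12]; rewrite ?zone_rim /=; lia.
- split.
  + by apply: joins_sub; rewrite ?zone_rim //=; lia.
  + by apply: joins_sub; rewrite ?zone_rim //=; lia.
  + by apply: (@joins_trans H _ (rim n z)); apply: joins_sub; rewrite ?zone_rim //=; lia.
- by rewrite !zone_rim /=; lia.
- by rewrite !zone_rim /=; lia.
- by [].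
- by [].
- by rewrite !zone_rim /=; lia.
by case=> [t|[j|b]]; rewrite /= ?implybT //; lia.
Qed.

Section Cap.
Variable j : 'I_n.+2.
Let q := 3 * j + 1.

Lemma cap_bounds : q.+1 <= K. Proof. by rewrite /q; have := ltn_ord j; lia. Qed.

Lemma cap_edges : cb_adj (Cap j) (rim n q) /\ cb_adj (Cap j) (rim n q.+1).
Proof. by rewrite /= !inordK /q /under; have := ltn_ord j; lia. Qed.

(** The branch vertices are those of the K4 at the cap and the lower pole, which
    reaches the upper one through the rim vertex preceding the triangle. *)
Lemma cap_pole_nonplanar : e (Cap j) (Pole n false) -> ~ planar R H.
Proof.
move=> ejP; have qK := cap_bounds; have [jq jq1] := cap_edges.
apply: (@K5_hub R H (Cap j) (Pole n false) (Pole n true) (rim n q) (rim n q.+1)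
  (zone (pred1 q.-1) pred0 predT) (zone (pred1 q) pred0 (pred1 false))
  (zone (pred1 q.+1) pred0 (pred1 false)) (zone (pred2 q q.+1) pred0 pred0)
  (zone (pred1 q.+1) pred0 (pred1 true)) (zone (pred1 q) pred0 (pred1 true))).
- by rewrite /= !in_cons !in_nil !eq_rim //=; lia.
- by split=> //; apply: sub_e.
- split.
  + by apply: (@joins_trans H _ (rim n q.-1)); apply: joins_sub;
      rewrite ?zone_rim //=; lia.
  + by apply: joins_sub; rewrite ?zone_rim //=; lia.
  + by apply: joins_sub; rewrite ?zone_rim //=; lia.
- split.
  + by apply: joins_rims => [|t t12]; rewrite ?zone_rim /=; lia.
  + by apply: joins_sub; rewrite ?zone_rim //=; lia.
  + by apply: joins_sub; rewrite ?zone_rim //=; lia.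
- by [].
- by [].
- by [].
- by rewrite !zone_rim /=; lia.
- by rewrite !zone_rim /=; lia.
by case=> [t|[i|b]]; rewrite /= ?implybT //; lia.
Qed.


(** The two directions along the rim lead from rim a to the two rim vertices of
    the triangle under the cap; which is which depends on the side of a. *)
Lemma cap_rim_nonplanar a : a <= K -> ~~ under a j -> e (Cap j) (rim n a) ->
  ~ planar R H.
Proof.
move=> aK; rewrite /under => naj eja; have qK := cap_bounds.
have [jq jq1] := cap_edges; have [a_q a_q1] : a <> q /\ a <> q.+1 by rewrite /q; lia.
pose P2 t := (a <= t <= q) || (q < a) && ((t <= q) || (a <= t <= K)).
pose P3 t := (q < t <= a) || (a < q) && ((t <= a) || (q < t <= K)).
apply: (@K5_hub R H (Cap j) (rim n a) (Pole n true) (rim n q) (rim n q.+1)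
  (zone (pred1 a) pred0 (pred1 true)) (zone P2 pred0 pred0)
  (zone P3 pred0 pred0) (zone (pred2 q q.+1) pred0 pred0)
  (zone (pred1 q.+1) pred0 (pred1 true)) (zone (pred1 q) pred0 (pred1 true)));
  rewrite /P2 /P3.
- by rewrite /= !in_cons !in_nil !eq_rim //=; lia.
- by split=> //; apply: sub_e.
- split.
  + by apply: joins_sub; rewrite ?zone_rim //=; lia.
  + have [aq|aq] := ltnP a q; last rewrite joins_sym.
      by apply: joins_rims => [|t t12]; rewrite ?zone_rim /=; lia.
    by apply: joins_wrap => [|t t12]; rewrite ?zone_rim /=; lia.
  + have [aq|aq] := ltnP a q; last rewrite joins_sym.
      by apply: joins_wrap => [|t t12]; rewrite ?zone_rim /=; lia.
    by apply: joins_rims => [|t t12]; rewrite ?zone_rim /=; lia.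
- split.
  + by apply: joins_rims => [|t t12]; rewrite ?zone_rim /=; lia.
  + by apply: joins_sub; rewrite ?zone_rim //=; lia.
  + by apply: joins_sub; rewrite ?zone_rim //=; lia.
- by [].
- by rewrite !zone_rim /=; lia.
- by [].
- by rewrite !zone_rim /=; lia.
- by rewrite !zone_rim /=; lia.
by case=> [t|[i|b]]; rewrite /= ?implybT //; lia.
Qed.

End Cap.

(** As for a rim vertex: the second cap goes to the rim and then both ways. *)
Lemma caps_edge_nonplanar (j l : 'I_n.+2) : j < l -> e (Cap j) (Cap l) -> ~ planar R H.
Proof.
move=> jl ejl; have := cap_bounds l; have := cap_edges l; have := cap_edges j.
have [q Eq] : exists q, q = 3 * j + 1 by exists (3 * j + 1).
have [r Er] : exists r, r = 3 * l + 1 by exists (3 * l + 1).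
rewrite -Eq -Er => -[jq jq1] [lr lr1] rK; have qr : q.+1 < r by lia.
have cap_neq : (Cap j == Cap l) = false.
  by apply/eqP => -[] /(congr1 val) /=; lia.
have q_j : (j : nat) == (l : nat) = false by lia.
apply: (@K5_hub R H (Cap j) (Cap l) (Pole n true) (rim n q) (rim n q.+1)
  (zone pred0 (pred1 (l : nat)) (pred1 true))
  (zone (fun t => (t <= q) || (r < t <= K)) (pred1 (l : nat)) pred0)
  (zone (fun t => q < t <= r) (pred1 (l : nat)) pred0)
  (zone (pred2 q q.+1) pred0 pred0)
  (zone (pred1 q.+1) pred0 (pred1 true)) (zone (pred1 q) pred0 (pred1 true))).
- by rewrite /= !in_cons !in_nil !eq_rim ?cap_neq //=; lia.
- by split=> //; apply: sub_e.
- split.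
  + by apply: joins_sub; rewrite ?zone_rim //=; lia.
  + apply: (@joins_trans H _ (rim n r.+1)).
      by apply: joins_sub; rewrite ?zone_rim //=; lia.
    by rewrite joins_sym; apply: joins_wrap => [|t t12]; rewrite ?zone_rim /=; lia.
  + apply: (@joins_trans H _ (rim n r)).
      by apply: joins_sub; rewrite ?zone_rim //=; lia.
    by rewrite joins_sym; apply: joins_rims => [|t t12]; rewrite ?zone_rim /=; lia.
- split.
  + by apply: joins_rims => [|t t12]; rewrite ?zone_rim /=; lia.
  + by apply: joins_sub; rewrite ?zone_rim //=; lia.
  + by apply: joins_sub; rewrite ?zone_rim //=; lia.
- by rewrite /= q_j.
- by [].
- by [].
- by rewrite !zone_rim /=; lia.
- by rewrite !zone_rim /=; lia.
by case=> [t|[i|b]]; rewrite /= ?implybT //; lia.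
Qed.


Lemma new_edge_nonplanar x y : x != y -> ~~ cb_adj x y -> e x y -> ~ planar R H.
Proof.
pose sorted_pair (x y : vtx n) := match x, y with
  | inl i, inl j => i < j
  | inr (inl i), inr (inl j) => i < j
  | inr (inr b), inr (inr _) => b
  | inl _, _ | inr (inr _), inr (inl _) => false
  | _, _ => true end.
(* Both the hypotheses and the conclusion are symmetric in x and y. *)
wlog: x y / sorted_pair x y => [wl xy nxy exy|].
  have [|] : sorted_pair x y \/ sorted_pair y x.
  - move: xy; case: x y {nxy exy} => [i|[i|[]]] [j|[j|[]]] xy /=;
      rewrite /sorted_pair; auto.
    + by apply/orP; rewrite -neq_ltn; apply: contraNneq xy => /val_inj->.
    + by apply/orP; rewrite -neq_ltn; apply: contraNneq xy => /val_inj->.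
  - by move/wl; apply.
  by move/wl; apply; rewrite 1?eq_sym // 1?cb_adj_sym // e_sym.
case: x y => [i|[i|[]]] [j|[j|[]]] // ij xy nxy.
- rewrite -/(Rim i) -/(Rim j) !Rim_rim; apply: rims_edge_nonplanar => //.
  by apply/andP; split; [exact: ij | rewrite -ltnS ltn_ord].
- rewrite -/(Rim j) Rim_rim; apply: cap_rim_nonplanar => //.
  by rewrite -ltnS ltn_ord.
- exact: caps_edge_nonplanar.
- exact: cap_pole_nonplanar.
- exact: poles_edge_nonplanar.
Qed.

End ExtraEdge.

Lemma add_edge_capped_bipyramid_nonplanar (R : realType) n (x y : capped_bipyramid n) :
  x != y -> ~~ adj x y -> ~ planar R (add_edge x y).
Proof.
move=> xy nxy; apply: (@new_edge_nonplanar R n _ _ _ _ x y xy nxy).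
  by move=> u v uv; rewrite /add_edge_rel /= uv.
by rewrite /add_edge_rel xy eqxx orbT.
Qed.

(** * Bowed segments *)

Section Bow.
Local Open Scope classical_set_scope.
Local Open Scope ring_scope.
Variable R : realType.
Implicit Types (p q : R * R) (h t : R).

(** The segment from p to q bent vertically into a parabola; h = 0 gives the
    straight segment. *)
Definition bow p q h : set (R * R) :=
  (fun t => (p.1 + t * (q.1 - p.1), p.2 + t * (q.2 - p.2) + h * t * (1 - t)))
  @` `[0, 1].

Lemma bow_sub p q h : bow p q h `<=` bow q p h.
Proof.
move=> _ [t + <-]; rewrite /= in_itv /= => /andP[t0 t1].
exists (1 - t); first by rewrite /= in_itv /=; apply/andP; split; lra.
by congr pair; ring.
Qed.

Lemma bow_sym p q h : bow p q h = bow q p h.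
Proof. by apply/seteqP; split; exact: bow_sub. Qed.

Lemma bow_arc p q h : p != q -> h = 0 \/ p.1 != q.1 -> plane_arc p q (bow p q h).
Proof.
move=> pq hpq; exists (fun t =>
  (p.1 + t * (q.1 - p.1), p.2 + t * (q.2 - p.2) + h * t * (1 - t))); split=> //.
- apply: continuous_subspaceT => t.
  apply: (@cvg_pair _ _ _ _ (nbhs (p.1 + t * (q.1 - p.1)))
    (nbhs (p.2 + t * (q.2 - p.2) + h * t * (1 - t)))) => /=.
    apply: cvgD; [exact: cvg_cst|]; apply: cvgM; [exact: cvg_id|exact: cvg_cst].
  apply: cvgD.
    apply: cvgD; [exact: cvg_cst|]; apply: cvgM; [exact: cvg_id|exact: cvg_cst].
  apply: cvgM; first by apply: cvgM; [exact: cvg_cst|exact: cvg_id].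
  by apply: cvgB; [exact: cvg_cst|exact: cvg_id].
- move=> s t _ _ [e1 e2].
  have [/eqP pq1|pq1] := eqVneq p.1 q.1; last first.
    have /mulIf : q.1 - p.1 != 0 by rewrite subr_eq0 eq_sym.
    by apply; lra.
  have h0 : h = 0 by case: hpq => //; rewrite pq1.
  have /mulIf : q.2 - p.2 != 0.
    rewrite subr_eq0 eq_sym; apply: contra pq => /eqP pq2.
    by rewrite -pair_eqE /pair_eq /= pq1 pq2 eqxx.
  by apply; move: e2; rewrite h0; lra.
- by case: p {pq hpq} => a b /=; congr pair; ring.
- by case: q {pq hpq} => a b /=; congr pair; ring.
Qed.

End Bow.

(** * Planarity of the capped bipyramid *)

Section Drawing.
Local Open Scope classical_set_scope.
Local Open Scope ring_scope.
Variables (R : realType) (n : nat).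
Notation K := (3 * n + 5)%N.
Notation KR := (3 * n%:R + 5 : R).

(** Each cap is halfway between the upper pole and the middle of its rim edge. *)
Definition pt (x : vtx n) : R * R :=
  match x with
  | inl i => ((i : nat)%:R, 0)
  | inr (inl j) => ((3 * (j : nat)%:R + 3 / 2 + KR / 2) / 2, 1 / 2)
  | inr (inr b) => (KR / 2, if b then 1 else -1)
  end.

Definition closing (x y : vtx n) : bool :=
  match x, y with
  | inl i, inl j => (i == 0%N :> nat) && (j == K :> nat)
                 || (j == 0%N :> nat) && (i == K :> nat)
  | _, _ => false
  end.

(** The height factor 8 makes the closing parabola pass over the upper pole, at
    height 2, and stay above the segments from that pole to the two ends of the
    rim. *)
Definition arc (x y : vtx n) : set (R * R) :=
  bow (pt x) (pt y) (if closing x y then 8 else 0).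

Inductive edge :=
  | Axis of nat | Closing | Up of nat | Down of nat
  | CapUp of 'I_n.+2 | CapLeft of 'I_n.+2 | CapRight of 'I_n.+2.

Definition edge_ok d : bool :=
  match d with
  | Axis i => (i < K)%N | Up i | Down i => (i <= K)%N | _ => true end.

Definition ends d : vtx n * vtx n :=
  match d with
  | Axis i => (rim n i, rim n i.+1)
  | Closing => (rim n 0, rim n K)
  | Up i => (rim n i, Pole n true)
  | Down i => (rim n i, Pole n false)
  | CapUp j => (Cap j, Pole n true)
  | CapLeft j => (Cap j, rim n (3 * j + 1))
  | CapRight j => (Cap j, rim n (3 * j + 2))
  end.

(** The abscissa at height y on the line from (x, 0) to the upper pole. *)
Definition ray (x y : R) : R := (1 - y) * x + y * (KR / 2).

(** The arc of each edge in coordinates adapted to comparing two of them at the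
    same height: points off the axis are located by the [ray] through them. *)
Definition region d : set (R * R) :=
  match d with
  | Axis i => [set p | p.2 = 0 /\ i%:R <= p.1 <= i%:R + 1]
  | Closing => [set p | exists2 t, 0 <= t <= 1 & p = (t * KR, 8 * t * (1 - t))]
  | Up i => [set p | 0 <= p.2 <= 1 /\ p.1 = ray i%:R p.2]
  | Down i => [set p | -1 <= p.2 <= 0 /\ p.1 = ray i%:R (- p.2)]
  | CapUp j => [set p | 1/2 <= p.2 <= 1 /\
                        p.1 = ray (3 * (j : nat)%:R + 3 / 2) p.2]
  | CapLeft j => [set p | 0 <= p.2 <= 1/2 /\
                          p.1 = ray (3 * (j : nat)%:R + 1) p.2 + p.2 / 2]
  | CapRight j => [set p | 0 <= p.2 <= 1/2 /\
                           p.1 = ray (3 * (j : nat)%:R + 2) p.2 - p.2 / 2]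
  end.

Lemma pt_rim i : (i <= K)%N -> pt (rim n i) = (i%:R, 0).
Proof. by move=> iK; rewrite /= inordK. Qed.

Lemma arc_sym x y : arc x y = arc y x.
Proof.
have -> : arc y x = bow (pt y) (pt x) (if closing x y then 8 else 0).
  by rewrite /arc; case: x y => [i|[?|?]] [j|[?|?]] //=; rewrite orbC.
exact: bow_sym.
Qed.

Lemma KRE : KR = K%:R.
Proof. by rewrite natrD natrM. Qed.

Lemma Rim_eq (i : 'I_K.+1) t : t = i :> nat -> rim n t = Rim i.
Proof. by move=> ->; rewrite -Rim_rim. Qed.

Lemma adj_edge (x y : capped_bipyramid n) : adj x y ->
  exists2 d, edge_ok d & ends d = (x, y) \/ ends d = (y, x).
Proof.
have rim_rim (i i' : 'I_K.+1) : cyc n i i' -> exists2 d, edge_ok d &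
    ends d = (Rim i, Rim i') \/ ends d = (Rim i', Rim i).
  have := (ltn_ord i, ltn_ord i') => -[ltI ltI'].
  case/or4P => [/eqP ii'|/eqP ii'|/andP[/eqP i0 /eqP i'K]|/andP[/eqP i'0 /eqP iK]].
  - exists (Axis i); first by rewrite /=; lia.
    by left; rewrite /= (@Rim_eq i) // (@Rim_eq i').
  - exists (Axis i'); first by rewrite /=; lia.
    by right; rewrite /= (@Rim_eq i') // (@Rim_eq i).
  - by exists Closing => //; left; rewrite /= (@Rim_eq i) // (@Rim_eq i').
  by exists Closing => //; right; rewrite /= (@Rim_eq i') // (@Rim_eq i).
have rim_pole (i : 'I_K.+1) (b : bool) :
    exists2 d, edge_ok d & ends d = (Rim i, Pole n b).
  have iK : (i <= K)%N by rewrite -ltnS ltn_ord.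
  by case: b; [exists (Up i)|exists (Down i)]; rewrite //= (@Rim_eq i).
have cap_rim (i : 'I_K.+1) (j : 'I_n.+2) : under i j ->
    exists2 d, edge_ok d & ends d = (Cap j, Rim i).
  by case/orP=> /eqP ij; [exists (CapLeft j)|exists (CapRight j)];
    rewrite //= (@Rim_eq i).
case: x y => [i|[j|b]] [i'|[j'|b']] //=; first exact: rim_rim.
- by move=> /cap_rim[d okd endsd]; exists d => //; right.
- by move=> _; have [d okd endsd] := rim_pole i b'; exists d => //; left.
- by move=> /cap_rim[d okd endsd]; exists d => //; left.
- by case: b' => // _; exists (CapUp j) => //; left.
- by move=> _; have [d okd endsd] := rim_pole i' b; exists d => //; right.
by case: b => // _; exists (CapUp j') => //; right.
Qed.

Lemma closing_rim i j : (i <= K)%N -> (j <= K)%N -> closing (rim n i) (rim n j) =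
  ((i == 0) && (j == K) || (j == 0) && (i == K))%N.
Proof. by move=> iK jK; rewrite /= !inordK. Qed.

Lemma arc_region d : edge_ok d -> arc (ends d).1 (ends d).2 `<=` region d.
Proof.
move=> okd p; rewrite /arc /bow => -[t]; rewrite /= in_itv /= => /andP[t0 t1].
case: d okd => [i||i|i|j|j|j] okd <-.
- have [iK i1K] : (i <= K /\ i.+1 <= K)%N by move: okd => /=; lia.
  rewrite [ends _]/= closing_rim // !pt_rim //.
  have -> : (((i == 0) && (i.+1 == K) || (i.+1 == 0) && (i == K)) = false)%N by lia.
  rewrite /= -natr1; split; first by ring.
  by apply/andP; split; lra.
- rewrite [ends _]/= closing_rim // !pt_rim // !eqxx /=; exists t; first by rewrite t0.
  by rewrite natrD natrM; congr pair; ring.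
- rewrite [ends _]/= [closing _ _]/= pt_rim // /= /ray; split; last by ring.
  by apply/andP; split; lra.
- rewrite [ends _]/= [closing _ _]/= pt_rim // /= /ray; split; last by ring.
  by apply/andP; split; lra.
- rewrite /= /ray; split; last by field.
  by apply/andP; split; lra.
- have jK : (3 * j + 1 <= K)%N by have := ltn_ord j; lia.
  rewrite [ends _]/= [closing _ _]/= pt_rim // /= /ray natrD natrM; split; last by field.
  by apply/andP; split; lra.
have jK : (3 * j + 2 <= K)%N by have := ltn_ord j; lia.
rewrite [ends _]/= [closing _ _]/= pt_rim // /= /ray natrD natrM; split; last by field.
by apply/andP; split; lra.
Qed.

Lemma natR_lt (a b : nat) : a%:R < b%:R + 1 :> R -> (a <= b)%N.
Proof. by rewrite natr1 ltr_nat ltnS. Qed.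

Lemma natR_between (a b : nat) : a%:R < b%:R + 1 :> R -> b%:R < a%:R + 1 :> R -> a = b.
Proof. by move=> /natR_lt ab /natR_lt ba; apply/eqP; rewrite eqn_leq ab ba. Qed.

Lemma ray_inj (a b y : R) : y < 1 -> ray a y = ray b y -> a = b.
Proof.
move=> y1 /addIr; apply: mulfI; rewrite subr_eq0; apply/eqP; lra.
Qed.

Lemma KR_gt0 : 0 < KR.
Proof. by have := ler0n R n; lra. Qed.

(** A point of the closing parabola in the triangle spanned by the upper pole and
    the two ends of the rim satisfies y <= 2 t and y <= 2 (1 - t), while
    y = 8 t (1 - t); this forces t = 0 or t = 1. *)
Lemma closing_above (t y : R) : 0 <= t <= 1 -> y = 8 * t * (1 - t) ->
  ray 0 y <= t * KR <= ray KR y -> y = 0 /\ (t = 0 \/ t = 1).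
Proof.
have K0 := KR_gt0; rewrite /ray => /andP[t0 t1] yt /andP[lo hi].
have {}lo : y <= 2 * t by rewrite -(ler_pM2r K0); lra.
have {}hi : y <= 2 * (1 - t) by rewrite -(ler_pM2r K0); lra.
have [t_0|t_neq0] := eqVneq t 0; first by split; [rewrite yt t_0; ring|left].
have [t_1|t_neq1] := eqVneq t 1; first by split; [rewrite yt t_1; ring|right].
have t_gt0 : 0 < t by rewrite lt_def t_neq0.
have t_lt1 : 0 < 1 - t by rewrite subr_gt0 lt_def eq_sym t_neq1.
have : 4 * (1 - t) <= 1 by rewrite -(ler_pM2r t_gt0); lra.
have : 4 * t <= 1 by rewrite -(ler_pM2r t_lt1); lra.
lra.
Qed.

Definition is_end d z := (z == (ends d).1) || (z == (ends d).2).

Definition meets d d' (p : R * R) := exists2 z, is_end d z && is_end d' z & p = pt z.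

Lemma eq_or_meets_sym d d' p : d = d' \/ meets d d' p -> d' = d \/ meets d' d p.
Proof. by case=> [->|[z]]; [left|rewrite andbC; right; exists z]. Qed.

Lemma meets_rim d d' i (p : R * R) : (i <= K)%N -> p.1 = i%:R -> p.2 = 0 ->
  is_end d (rim n i) -> is_end d' (rim n i) -> meets d d' p.
Proof.
move=> iK p1 p2 di d'i; exists (rim n i); first by rewrite di.
by rewrite pt_rim // -p1 -p2; case: p {p1 p2}.
Qed.

Lemma meets_pole d d' b (p : R * R) : p.1 = KR / 2 -> p.2 = (if b then 1 else -1) ->
  is_end d (Pole n b) -> is_end d' (Pole n b) -> meets d d' p.
Proof.
move=> p1 p2 db d'b; exists (Pole n b); first by rewrite db.
by rewrite /= -p1 -p2; case: p {p1 p2}.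
Qed.

Lemma meets_cap d d' j (p : R * R) :
  p.1 = ray (3 * (j : 'I_n.+2)%:R + 3 / 2) (1 / 2) -> p.2 = 1 / 2 ->
  is_end d (Cap j) -> is_end d' (Cap j) -> meets d d' p.
Proof.
move=> p1 p2 dj d'j; exists (Cap j); first by rewrite dj.
case: p p1 p2 => x y /= -> ->; by congr pair; rewrite /ray; field.
Qed.

(** A drawn edge other than those of the axis touches it only at vertices. *)
Lemma axis_meets i d p : edge_ok (Axis i) -> edge_ok d -> region (Axis i) p ->
  region d p -> Axis i = d \/ meets (Axis i) d p.
Proof.
move=> /= iK okd [p2 /andP[ip pi1]].
have endi k : (i%:R <= k%:R :> R) && (k%:R <= i%:R + 1 :> R) -> k = i \/ k = i.+1.
  by rewrite natr1 !ler_nat; lia.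
have on_rim k : p.1 = k%:R -> is_end d (rim n k) -> Axis i = d \/ meets (Axis i) d p.
  move=> pk dk; have ki : k = i \/ k = i.+1 by apply: endi; rewrite -pk ip.
  right; apply: (@meets_rim _ _ k) => //; first by case: ki => ->; lia.
  by case: ki => ->; rewrite /is_end eqxx ?orbT.
case: d okd on_rim => [j||j|j|j|j|j] okd on_rim /=.
- move=> [_ /andP[jp pj1]].
  have [ij ji] : (i <= j.+1 /\ j <= i.+1)%N.
    by split; rewrite -(ler_nat R) -natr1; lra.
  have [->|[ij1|ji1]] : i = j \/ j = i.+1 \/ i = j.+1 by lia.
  + by left.
  + apply: (on_rim j); last by rewrite /is_end eqxx.
    by apply/eqP; rewrite eq_le jp ij1 -natr1 pi1.
  + apply: (on_rim i); last by rewrite /is_end ji1 eqxx orbT.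
    by apply/eqP; rewrite eq_le ip ji1 -natr1 pj1.
- case=> t /andP[t0 t1] E; have : t * (1 - t) = 0 by move: p2; rewrite E /=; lra.
  move/eqP; rewrite mulf_eq0 => /orP[/eqP t_0|/eqP t_1].
    by apply: (on_rim 0%N); [rewrite E /= t_0 mul0r|rewrite /is_end eqxx].
  apply: (on_rim K); last by rewrite /is_end eqxx orbT.
  have t1E : t = 1 by lra.
  by rewrite E /= -KRE t1E mul1r.
- by rewrite p2 /ray => -[_ e]; apply: (on_rim j); [rewrite e; ring|rewrite /is_end eqxx].
- by rewrite p2 /ray => -[_ e]; apply: (on_rim j); [rewrite e; ring|rewrite /is_end eqxx].
- by rewrite p2 => -[/andP[y_ge _] _]; exfalso; lra.
- rewrite p2 /ray => -[_ e]; apply: (on_rim (3 * j + 1)%N);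
    last by rewrite /is_end eqxx orbT.
  by rewrite e natrD natrM; ring.
- rewrite p2 /ray => -[_ e]; apply: (on_rim (3 * j + 2)%N);
    last by rewrite /is_end eqxx orbT.
  by rewrite e natrD natrM; ring.
Qed.


Lemma closing_meets d p : edge_ok d -> region Closing p -> region d p ->
  Closing = d \/ meets Closing d p.
Proof.
move=> okd; have K0 := KR_gt0; case=> t t01 pE.
have p2E : p.2 = 8 * t * (1 - t) by rewrite pE.
have p1E : p.1 = t * KR by rewrite pE.
have p2_ge0 : 0 <= p.2.
  by case/andP: t01 => t0 t1; rewrite p2E !mulr_ge0 ?subr_ge0.
have top (x y : R) : p.1 = x -> p.2 = y -> ray 0 y <= x <= ray KR y ->
    y = 0 /\ (x = 0 \/ x = KR).
  move=> <- <-; rewrite p1E => strip.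
  have [-> [->|->]] := closing_above t01 p2E strip; split=> //.
    by left; rewrite mul0r.
  by right; rewrite mul1r.
have foot i : (i <= K)%N -> p.2 = 0 -> p.1 = i%:R -> p.1 = 0 \/ p.1 = KR ->
    is_end d (rim n i) -> Closing = d \/ meets Closing d p.
  move=> iK p2 p1 p1_end di; right; apply: (@meets_rim _ _ i) => //.
  case: p1_end; rewrite p1 => i_end; rewrite /is_end /=.
    by have -> : i = 0%N by [apply/eqP; rewrite -(eqr_nat R) i_end]; rewrite eqxx.
  have -> : i = K by [apply/eqP; rewrite -(eqr_nat R) i_end KRE].
  by rewrite eqxx orbT.
case: d okd foot => [i||i|i|j|j|j] okd foot.
- move=> ax; have clr : region Closing p by exists t.
  have [//|[z /andP[zi zd] pz]] := axis_meets okd (isT : edge_ok Closing) ax clr.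
  by right; exists z => //; rewrite zd.
- by left.
- move=> [/andP[y0 y1] xE].
  have i0 : 0 <= i%:R :> R := ler0n R i.
  have iKR : i%:R <= KR by rewrite KRE ler_nat.
  have [|y_0 ends] := top _ _ xE erefl.
    by rewrite /ray !lerD2r !ler_wpM2l ?subr_ge0.
  apply: (foot i) => //; last by rewrite /is_end eqxx.
    by rewrite xE y_0 /ray; ring.
  by rewrite xE.
- move=> [/andP[_ y_le0] xE].
  have y_0 : p.2 = 0 by lra.
  have p1i : p.1 = i%:R by rewrite xE y_0 /ray; ring.
  apply: (foot i) => //; last by rewrite /is_end eqxx.
  have [|_ //] := top _ _ erefl y_0.
  rewrite /ray p1i; have i0 : 0 <= i%:R :> R := ler0n R i.
  have iKR : i%:R <= KR by rewrite KRE ler_nat.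
  by apply/andP; split; lra.
- move=> [/andP[y_ge y_le] xE]; exfalso.
  have [|y_0 _] := top _ _ xE erefl; last by lra.
  have j0 : 0 <= (j : nat)%:R :> R := ler0n R j.
  have jn : (j : nat)%:R <= n%:R + 1 :> R by rewrite natr1 ler_nat -ltnS ltn_ord.
  by rewrite /ray !lerD2r !ler_wpM2l ?subr_ge0 //; lra.
- move=> [/andP[y_ge y_le] xE]; exfalso.
  have j0 : 0 <= (j : nat)%:R :> R := ler0n R j.
  have jn : (j : nat)%:R <= n%:R + 1 :> R by rewrite natr1 ler_nat -ltnS ltn_ord.
  have [|y_0 ends] := top _ _ xE erefl.
    by rewrite /ray; apply/andP; split; nra.
  by move: ends; rewrite y_0 /ray => -[]; lra.
move=> [/andP[y_ge y_le] xE].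
have j0 : 0 <= (j : nat)%:R :> R := ler0n R j.
have jn : (j : nat)%:R <= n%:R + 1 :> R by rewrite natr1 ler_nat -ltnS ltn_ord.
have [|y_0 ends] := top _ _ xE erefl.
  by rewrite /ray; apply/andP; split; nra.
apply: (foot (3 * j + 2)%N) => //.
- by have := ltn_ord j; lia.
- by rewrite xE y_0 natrD natrM /ray; ring.
- by rewrite xE.
by rewrite /is_end eqxx orbT.
Qed.


Lemma down_meets i d p : edge_ok (Down i) -> edge_ok d -> region (Down i) p ->
  region d p -> Down i = d \/ meets (Down i) d p.
Proof.
move=> iK okd rD; have [/andP[_ y_le0] xE] := rD.
have foot j : p.2 = 0 -> p.1 = j%:R -> is_end d (rim n j) ->
    meets (Down i) d p.
  move=> y_0 xj dj; have ij : i = j.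
    by apply/eqP; rewrite -(eqr_nat R) -xj xE y_0 /ray; apply/eqP; ring.
  by rewrite -ij in xj dj; apply: (meets_rim _ xj y_0 _ dj) => //; rewrite /is_end eqxx.
case: d okd foot => [j||j|j|j|j|j] okd foot.
- by move=> rd; apply/eq_or_meets_sym/axis_meets.
- by move=> rd; apply/eq_or_meets_sym/closing_meets.
- move=> [/andP[y_ge0 _] xE']; have y_0 : p.2 = 0 by lra.
  right; apply: (foot j) => //; last by rewrite /is_end eqxx.
  by rewrite xE' y_0 /ray; ring.
- move=> [/andP[y_ge _] xE'].
  have [y_gt|y_le] := ltrP (-1) p.2; last first.
    have y_1 : p.2 = -1 by lra.
    right; apply: (@meets_pole _ _ false) => //; rewrite /is_end ?eqxx ?orbT //.
    by rewrite xE y_1 /ray; ring.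
  left; congr Down; apply/eqP; rewrite -(eqr_nat R); apply/eqP.
  by apply: (@ray_inj _ _ (- p.2)); [lra|rewrite -xE].
- by move=> [/andP[y_ge _] _]; exfalso; lra.
- move=> [/andP[y_ge0 _] xE']; have y_0 : p.2 = 0 by lra.
  right; apply: (foot (3 * j + 1)%N) => //; last by rewrite /is_end eqxx orbT.
  by rewrite xE' y_0 /ray natrD natrM; ring.
move=> [/andP[y_ge0 _] xE']; have y_0 : p.2 = 0 by lra.
right; apply: (foot (3 * j + 2)%N) => //; last by rewrite /is_end eqxx orbT.
by rewrite xE' y_0 /ray natrD natrM; ring.
Qed.

(** Below height 1/2 the edges from a cap to the rim deviate from a ray by at
    most half the distance of neighbouring rays. *)
Lemma ray_apart (a b s y : R) : 0 <= y <= 1 / 2 -> `|s| <= 1 ->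
  ray a y = ray b y + s * y / 2 -> a < b + 1 /\ b < a + 1.
Proof.
move=> /andP[y0 y2]; rewrite ler_norml => /andP[s1 s2]; rewrite /ray => e.
have {e}e : (1 - y) * (a - b) = s * y / 2 by lra.
by split; rewrite ltNge; apply/negP => ab; nra.
Qed.

Lemma up_meets i d p : edge_ok (Up i) -> edge_ok d -> region (Up i) p ->
  region d p -> Up i = d \/ meets (Up i) d p.
Proof.
move=> iK okd rU rd; have [/andP[y_ge0 y_le1] xE] := rU.
have apex : p.2 = 1 -> is_end d (Pole n true) -> Up i = d \/ meets (Up i) d p.
  move=> y_1 dN; right; apply: (@meets_pole _ _ true _ _ y_1 _ dN).
    by rewrite xE y_1 /ray; ring.
  by rewrite /is_end eqxx orbT.
have foot : p.2 = 0 -> is_end d (rim n i) -> Up i = d \/ meets (Up i) d p.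
  move=> y_0 di; right; apply: (meets_rim iK _ y_0 _ di).
    by rewrite xE y_0 /ray; ring.
  by rewrite /is_end eqxx.
case: d okd rd apex foot => [j||j|j|j|j|j] okd rd apex foot.
- exact/eq_or_meets_sym/axis_meets.
- exact/eq_or_meets_sym/closing_meets.
- case: rd => _ xE'; have [y_lt1|y_ge1] := ltrP p.2 1; last first.
    by apply: apex; [lra|rewrite /is_end eqxx orbT].
  left; congr Up; apply/eqP; rewrite -(eqr_nat R); apply/eqP.
  by apply: (@ray_inj _ _ p.2) => //; rewrite -xE.
- exact/eq_or_meets_sym/down_meets.
- case: rd => _ xE'; have [y_lt1|y_ge1] := ltrP p.2 1; last first.
    by apply: apex; [lra|rewrite /is_end eqxx orbT].
  have /(ray_inj y_lt1) e :
      ray i%:R p.2 = ray (3 * (j : nat)%:R + 3 / 2) p.2 by rewrite -xE.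
  exfalso; have : (2 * i)%:R = (6 * j + 3)%:R :> R by rewrite natrD !natrM e; field.
  by move/eqP; rewrite eqr_nat; lia.
- case: rd => y_half xE'.
  have e : ray i%:R p.2 = ray (3 * j + 1)%:R p.2 + 1 * p.2 / 2.
    by rewrite -xE xE' natrD natrM mul1r.
  have [|/natR_lt ij /natR_lt ji] := ray_apart y_half _ e; first by rewrite normr1.
  have ij1 : i = (3 * j + 1)%N by lia.
  rewrite -ij1 in e; apply: foot; last by rewrite ij1 /is_end eqxx orbT.
  by lra.
case: rd => y_half xE'.
have e : ray i%:R p.2 = ray (3 * j + 2)%:R p.2 + (-1) * p.2 / 2.
  by rewrite -xE xE' natrD natrM mulN1r mulNr.
have [|/natR_lt ij /natR_lt ji] := ray_apart y_half _ e; first by rewrite normrN normr1.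
have ij1 : i = (3 * j + 2)%N by lia.
rewrite -ij1 in e; apply: foot; last by rewrite ij1 /is_end eqxx orbT.
by lra.
Qed.

Definition cap_edge (j : 'I_n.+2) d :=
  [\/ d = CapUp j, d = CapLeft j | d = CapRight j].

(** At height y the edges at a cap stay within (1 - y) / 2 of its central ray,
    whereas the central rays of distinct caps are at least 3 (1 - y) apart. *)
Lemma cap_strip j d p : cap_edge j d -> region d p ->
  p.2 <= 1 /\ `|p.1 - ray (3 * (j : nat)%:R + 3 / 2) p.2| <= (1 - p.2) / 2.
Proof.
by case=> -> [/andP[y_ge y_le]]; rewrite ler_norml /ray => ->;
  (split; [lra|apply/andP; split; lra]).
Qed.

Lemma cap_meets j l d d' p : cap_edge j d -> cap_edge l d' ->
  region d p -> region d' p -> d = d' \/ meets d d' p.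
Proof.
move=> dj d'l rd rd'.
have [y_le1] := cap_strip dj rd; have [_] := cap_strip d'l rd'.
rewrite !ler_norml /ray => /andP[lo' hi'] /andP[lo hi].
have [y_1|y_neq1] := eqVneq p.2 1.
  right; apply: (@meets_pole _ _ true) => //.
  - by move: lo hi; rewrite y_1; lra.
  - by case: dj rd => -> [/andP[? ?] _];
      [rewrite /is_end eqxx orbT|exfalso; lra|exfalso; lra].
  by case: d'l rd' => -> [/andP[? ?] _];
      [rewrite /is_end eqxx orbT|exfalso; lra|exfalso; lra].
have y_lt1 : 0 < 1 - p.2 by rewrite subr_gt0 lt_def eq_sym y_neq1.
have le_jl : (3 * (j : nat)%:R - 3 * (l : nat)%:R : R) <= 1.
  by rewrite -(ler_pM2l y_lt1); lra.
have le_lj : (3 * (l : nat)%:R - 3 * (j : nat)%:R : R) <= 1.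
  by rewrite -(ler_pM2l y_lt1); lra.
have jl : j = l.
  apply: val_inj; apply: natR_between => /=; lra.
rewrite -jl in d'l => {l jl lo' hi' le_jl le_lj}.
have centre : p.2 = 1 / 2 -> d = d' \/ meets d d' p.
  move=> y_2; right; apply: (@meets_cap _ _ j) => //.
  - by rewrite /ray; move: lo hi; case: dj rd => -> [_ ->]; rewrite y_2 /ray; lra.
  - by case: dj => ->; rewrite /is_end eqxx.
  by case: d'l => ->; rewrite /is_end eqxx.
case: dj d'l rd rd' centre => -> [] ->; try by left.
all: by move=> [/andP[? ?] xE] [/andP[? ?] xE'] centre; apply: centre;
  move: xE'; rewrite xE /ray; lra.
Qed.

Lemma region_meets d d' p : edge_ok d -> edge_ok d' -> region d p -> region d' p ->
  d = d' \/ meets d d' p.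
Proof.
move=> okd okd' rd rd'.
have cap j : cap_edge j d -> d = d' \/ meets d d' p.
  move=> dj; case: d' okd' rd' => [i||i|i|l|l|l] okd' rd'.
  - exact/eq_or_meets_sym/axis_meets.
  - exact/eq_or_meets_sym/closing_meets.
  - exact/eq_or_meets_sym/up_meets.
  - exact/eq_or_meets_sym/down_meets.
  - by apply: (cap_meets dj (_ : cap_edge l _) rd rd'); constructor 1.
  - by apply: (cap_meets dj (_ : cap_edge l _) rd rd'); constructor 2.
  - by apply: (cap_meets dj (_ : cap_edge l _) rd rd'); constructor 3.
case: d okd rd cap => [i||i|i|j|j|j] okd rd cap.
- exact: axis_meets.
- exact: closing_meets.
- exact: up_meets.
- exact: down_meets.
- by apply: (cap j); constructor 1.
- by apply: (cap j); constructor 2.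
- by apply: (cap j); constructor 3.
Qed.

Lemma pt_inj : injective pt.
Proof.
case=> [i|[j|b]] [i'|[j'|b']] //= [].
- by move/eqP; rewrite eqr_nat => /eqP/val_inj->.
- by move=> _ e; exfalso; lra.
- by case: b' => _ e; exfalso; lra.
- by move=> _ e; exfalso; lra.
- by move=> e; congr (inr (inl _)); apply: val_inj; apply: natR_between; lra.
- by case: b' => _ e; exfalso; lra.
- by case: b => _ e; exfalso; lra.
- by case: b => _ e; exfalso; lra.
by case: b; case: b' => // e; exfalso; lra.
Qed.

Lemma arc_plane_arc (x y : capped_bipyramid n) : adj x y ->
  plane_arc (pt x) (pt y) (arc x y).
Proof.
move=> xy; apply: bow_arc.
  by rewrite (inj_eq pt_inj); apply: contraTneq xy => ->; rewrite adj_irr.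
case: ifP => cl; [right|by left].
case: x y cl {xy} => [i|[?|?]] [j|[?|?]] //=.
by case/orP => /andP[/eqP-> /eqP->]; rewrite eqr_nat; lia.
Qed.

Lemma arc_meets (x y u v : capped_bipyramid n) : adj x y -> adj u v ->
  [set x; y]%SET != [set u; v]%SET ->
  arc x y `&` arc u v `<=` [set pt x; pt y].
Proof.
have reg (a b : capped_bipyramid n) d : ends d = (a, b) \/ ends d = (b, a) -> edge_ok d ->
    arc a b `<=` region d.
  by move=> [e|e] okd; have := arc_region okd; rewrite e // arc_sym.
move=> xy uv xy_uv p [pxy puv].
have [d okd dE] := adj_edge xy; have [d' okd' d'E] := adj_edge uv.
have [dd'|] := region_meets okd okd' (reg _ _ _ dE okd _ pxy) (reg _ _ _ d'E okd' _ puv).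
  exfalso; move/eqP: xy_uv; apply; rewrite -dd' in d'E.
  case: dE d'E => -> [] [-> ->] //; first by rewrite finset.setUC.
  by rewrite finset.setUC.
case=> z /andP[zd _] ->; move: zd; rewrite /is_end.
by case: dE => -> /orP[] /eqP-> /=; [left|right|right|left].
Qed.

(** No arc passes through a further vertex z, because z lies on the arc of some
    edge at z. *)
Theorem capped_bipyramid_planar : planar R (capped_bipyramid n).
Proof.
exists pt, arc; split.
- exact: pt_inj.
- by move=> x y _; exact: arc_sym.
- exact: arc_plane_arc.
- move=> x y z xy xyz.
  have [w zw] : exists w : capped_bipyramid n, adj z w.
    by case: (z) => [i|[j|b]];
      [exists (Pole n true)|exists (Pole n true)|exists (rim n 0)].
  have [-> | zx] := eqVneq z x; first by left.
  have [-> | zy] := eqVneq z y; first by right.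
  have [pz _] := plane_arc_ends (arc_plane_arc zw).
  have neq : [set x; y]%SET != [set z; w]%SET.
    apply: contraNneq zx => e; have : z \in [set x; y]%SET by rewrite e set21.
    by rewrite !inE (negPf zy) orbF.
  by have [/pt_inj|/pt_inj] := arc_meets xy zw neq (conj xyz pz); [left|right].
exact: arc_meets.
Qed.

End Drawing.

(** * Conclusion *)

Theorem mainTheorem3 (R : realType) (N : nat) :
  exists G : sgraph,
    [/\ N <= #|G|, maximal_planar R G, chromatic_number G = 4 & mp G = 4].
Proof.
exists (capped_bipyramid N); split.
- exact: card_capped_bipyramid.
- split; first exact: capped_bipyramid_planar.
  by move=> x y; exact: add_edge_capped_bipyramid_nonplanar.
- exact: chromatic_number_capped_bipyramid.
- exact: mp_capped_bipyramid.
Qed.
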